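(* Let $q>3$ be a prime with $q\not\equiv 1\pmod 4$. Up to isomorphism, the left braces of order $4q$ with additive group isomorphic to $\mathbb{Z}_2^2\times\mathbb{Z}_q$ and with $|\ker\lambda|=2q$ are exactly the three braces $B_{i,j}$ for $(i,j)\in\{(1,0),(0,1),(1,1)\}$, which are pairwise non-isomorphic, where $B_{i,j}=(\mathbb{Z}_q\times\mathbb{Z}_2\times\mathbb{Z}_2,+,\circ)$ with $$\begin{pmatrix} n\\ m\\ l\end{pmatrix}+\begin{pmatrix} x\\ y\\ z\end{pmatrix}=\begin{pmatrix} n+x\\ m+y\\ l+z\end{pmatrix},\qquad \begin{pmatrix} n\\ m\\ l\end{pmatrix}\circ\begin{pmatrix} x\\ y\\ z\end{pmatrix}=\begin{pmatrix} n+(-1)^{il}x\\ m+y+jlz\\ l+z\end{pmatrix}$$ for all $n,x\in\mathbb{Z}_q$ and $m,l,y,z\in\mathbb{Z}_2$. In particular, $$(B_{i,j},\circ)\cong\begin{cases}\mathbb{Z}_2\times(\mathbb{Z}_q\rtimes_{-1}\mathbb{Z}_2) & \text{if }(i,j)=(1,0),\\ \mathbb{Z}_q\rtimes_{-1}\mathbb{Z}_4 & \text{if }(i,j)=(1,1),\\ \mathbb{Z}_{4q} & \text{if }(i,j)=(0,1).\end{cases}$$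
   Context: A skew (left) brace is a triple $(B,+,\circ)$ where $(B,+)$ and $(B,\circ)$ are groups such that $a\circ(b+c)=a\circ b-a+a\circ c$ for all $a,b,c\in B$; it is a left brace if $(B,+)$ is abelian. The map $\lambda:(B,\circ)\to\mathrm{Aut}(B,+)$, $\lambda_a(b)=-a+a\circ b$, is a group homomorphism, with kernel $\ker\lambda$. Isomorphisms are bijections preserving both operations. $\mathbb{Z}_q\rtimes_{-1}\mathbb{Z}_4=\langle\sigma,\tau\mid\sigma^4=\tau^q=1,\ \sigma\tau\sigma^{-1}=\tau^{-1}\rangle$, and $\mathbb{Z}_q\rtimes_{-1}\mathbb{Z}_2$ is the dihedral group of order $2q$. *)

(* Defs.v *)
From HB Require Import structures.
From mathcomp Require Import all_boot all_order all_algebra all_fingroup.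
From mathcomp Require Import all_solvable.

Set Implicit Arguments.
Unset Strict Implicit.
Unset Printing Implicit Defensive.

Import GRing.Theory.

(* Finite skew braces.  The carrier bears two group laws at once, so neither   *)
(* is declared as a canonical structure on it: see addgrp and circgrp below.   *)
Record skew_brace := SkewBrace {
  carrier :> finType;
  badd : carrier -> carrier -> carrier;
  bzero : carrier;
  bopp : carrier -> carrier;
  bcirc : carrier -> carrier -> carrier;
  bone : carrier;
  binv : carrier -> carrier;
  baddA : associative badd;
  badd0b : left_id bzero badd;
  baddNb : left_inverse bzero bopp badd;
  bcircA : associative bcirc;
  bcirc1b : left_id bone bcirc;
  bcircVb : left_inverse bone binv bcirc;
  bcircDr : forall a b c,
    bcirc a (badd b c) = badd (badd (bcirc a b) (bopp a)) (bcirc a c)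
}.

(* (B, +) and (B, \circ) as finGroupTypes, both written multiplicatively.      *)
Definition addgrp (B : skew_brace) : Type := carrier B.
HB.instance Definition _ (B : skew_brace) := Finite.on (addgrp B).
HB.instance Definition _ (B : skew_brace) :=
  Finite_isGroup.Build (addgrp B) (@baddA B) (@badd0b B) (@baddNb B).

Definition circgrp (B : skew_brace) : Type := carrier B.
HB.instance Definition _ (B : skew_brace) := Finite.on (circgrp B).
HB.instance Definition _ (B : skew_brace) :=
  Finite_isGroup.Build (circgrp B) (@bcircA B) (@bcirc1b B) (@bcircVb B).

Definition is_left_brace (B : skew_brace) : bool := abelian [set: addgrp B].

Definition brace_iso (A B : skew_brace) : Prop :=
  exists f : A -> B,
    [/\ bijective f, {morph f : x y / badd x y} & {morph f : x y / bcirc x y}].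

Section Lambda.

Variable B : skew_brace.

Definition lambda_fun (a : circgrp B) (b : addgrp B) : addgrp B :=
  badd (bopp a) (bcirc a b).

Lemma lambda_inj a : injective (lambda_fun a).
Proof.
move=> b c eq_bc.
by have /(mulgI (a : circgrp B)) := mulgI ((a : addgrp B)^-1)%g _ _ eq_bc.
Qed.

Definition lambda (a : circgrp B) : {perm addgrp B} := perm (@lambda_inj a).

Lemma lambda_Aut a : lambda a \in Aut [set: addgrp B].
Proof.
rewrite inE; apply/andP; split; first by apply/subsetP=> x; rewrite inE.
apply/morphicP=> x y _ _; rewrite !permE /lambda_fun.
have -> : bcirc a ((x : addgrp B) * (y : addgrp B))%g =
    badd (badd (bcirc a x) (bopp a)) (bcirc a y) by exact: bcircDr.
rewrite -[X in badd _ X]baddA; exact: baddA.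
Qed.

(* Permutations compose from left to right in MathComp, hence the reversed     *)
(* product: this is the statement that lambda is a homomorphism.               *)
Lemma lambdaM (a b : circgrp B) : lambda (a * b)%g = (lambda b * lambda a)%g.
Proof.
apply/permP=> x; rewrite permM.
have /setIdP[_ /morphicP laM] := lambda_Aut a.
have -> : lambda b x = ((b : addgrp B)^-1 * (b * (x : circgrp B))%g)%g.
  by rewrite permE.
rewrite laM ?inE //.
have -> : lambda a (b : addgrp B)^-1%g = (lambda a (b : addgrp B))^-1%g.
  apply/eqP; rewrite eq_sym eq_invg_mul -laM ?inE // mulgV.
  by apply/eqP/(mulgI (lambda a 1%g)); rewrite -laM ?inE // !mulg1.
rewrite !permE /lambda_fun.
set ab := bcirc a b.
transitivity ((ab : addgrp B)^-1 * bcirc ab x : addgrp B)%g => //.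
have -> : bcirc a ((b : circgrp B) * (x : circgrp B))%g = bcirc ab x.
  exact: bcircA.
set u : addgrp B := bcirc ab x.
transitivity (((a : addgrp B)^-1 * (ab : addgrp B))^-1
               * ((a : addgrp B)^-1 * u))%g => //.
by rewrite invMg invgK -mulgA mulKVg.
Qed.

Definition ker_lambda : {set circgrp B} := [set a | lambda a == 1%g].

End Lambda.

Section BraceFamily.

Local Open Scope ring_scope.

Variables (q : nat) (i j : 'Z_2).

Local Notation T := ('Z_q * 'Z_2 * 'Z_2)%type.

Definition bij_add (u v : T) : T :=
  let: (n, m, l) := u in let: (x, y, z) := v in (n + x, m + y, l + z).

Definition bij_opp (u : T) : T := let: (n, m, l) := u in (- n, - m, - l).

(* The exponent i * l is the product in nat of the representatives in {0, 1}. *)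
Definition bij_circ (u v : T) : T :=
  let: (n, m, l) := u in let: (x, y, z) := v in
  (n + (-1) ^+ (i * l) * x, m + y + j * l * z, l + z).

Definition bij_inv (u : T) : T :=
  let: (n, m, l) := u in (- ((-1) ^+ (i * l) * n), - m + j * l * l, - l).

Lemma bij_addA : associative bij_add.
Proof. by move=> [[n m] l] [[x y] z] [[a b] c]; rewrite /= !addrA. Qed.

Lemma bij_add0 : left_id (0, 0, 0) bij_add.
Proof. by move=> [[n m] l]; rewrite /= !add0r. Qed.

Lemma bij_addN : left_inverse (0, 0, 0) bij_opp bij_add.
Proof. by move=> [[n m] l]; rewrite /= !addNr. Qed.

Lemma Z2P (P : 'Z_2 -> Prop) : P 0 -> P 1 -> forall x, P x.
Proof.
move=> P0 P1 [[|[|//]] ltx].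
  by rewrite (_ : Ordinal ltx = 0) //; apply: val_inj.
by rewrite (_ : Ordinal ltx = 1) //; apply: val_inj.
Qed.

Lemma Z2opp (x : 'Z_2) : - x = x.
Proof. by elim/Z2P: x; apply: val_inj. Qed.

Lemma signZ2D (x y : 'Z_2) :
  (-1) ^+ (i * (x + y)%R) = (-1) ^+ (i * x) * (-1) ^+ (i * y) :> 'Z_q.
Proof.
rewrite -exprD -signr_odd -[RHS]signr_odd; congr (_ ^+ nat_of_bool _).
by elim/Z2P: i; elim/Z2P: x; elim/Z2P: y.
Qed.

Lemma bij_circA : associative bij_circ.
Proof.
move=> [[n m] l] [[x y] z] [[a b] c] /=; congr (_, _, _); last by rewrite addrA.
  by rewrite signZ2D mulrDr addrA mulrA.
rewrite !mulrDr !mulrDl -!addrA; do 2 congr (_ + _).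
rewrite [RHS]addrCA; congr (_ + _).
by rewrite addrCA; congr (_ + _); rewrite addrC.
Qed.

Lemma bij_circ1 : left_id (0, 0, 0) bij_circ.
Proof.
by move=> [[n m] l]; rewrite /= muln0 expr0 mulr0 !mul0r mul1r !add0r addr0.
Qed.

Lemma bij_circV : left_inverse (0, 0, 0) bij_inv bij_circ.
Proof.
move=> [[n m] l].
transitivity (- ((-1) ^+ (i * l) * n) + (-1) ^+ (i * (- l)%R) * n,
              - m + j * l * l + m + j * - l * l, - l + l) => //.
rewrite [- l + l]addNr (Z2opp l) addNr.
have -> : - m + j * l * l + m + j * l * l = 0.
  by rewrite [- m + _ + m]addrAC addNr add0r -{1}[j * l * l]Z2opp addNr.
by [].
Qed.

Lemma bij_circD u v w :
  bij_circ u (bij_add v w) =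
  bij_add (bij_add (bij_circ u v) (bij_opp u)) (bij_circ u w).
Proof.
case: u v w => [[n m] l] [[x y] z] [[a b] c] /=; congr (_, _, _).
- by rewrite mulrDr [n + _ - n]addrAC subrr add0r addrCA.
- rewrite [m + y + _ - m]addrAC [m + y - m]addrAC subrr add0r mulrDr.
  by rewrite [RHS]addrACA [y + (m + b)]addrCA.
- by rewrite [l + z - l]addrAC subrr add0r addrCA.
Qed.

Definition brace_Bij : skew_brace :=
  @SkewBrace T bij_add (0, 0, 0) bij_opp bij_circ (0, 0, 0) bij_inv
    bij_addA bij_add0 bij_addN bij_circA bij_circ1 bij_circV bij_circD.

End BraceFamily.

(* Main.v *)
Require Import Defs.
From mathcomp Require Import all_boot all_order all_algebra all_fingroup.
From mathcomp Require Import all_solvable.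

(* The kernel K of lambda has index 2 in (B, o) and is also a subgroup of     *)
(* index 2 of (B, +), since o and + agree on it. Hence (B, +) has generators  *)
(* p, e in K and f outside K, of orders q, 2 and 2, and lambda is trivial on  *)
(* K and equal to the involution theta = lambda_f elsewhere. Now theta maps p *)
(* to p or -p, fixes e, the only involution of K, and sends f to f or e + f   *)
(* because it preserves the complement of K; these two choices are the        *)
(* parameters i and j. Conversely i = 0 iff o is commutative, and j = 0 iff   *)
(* every x with x + x = 0 satisfies x o x = 0, so distinct B_ij are not       *)
(* isomorphic.                                                                *)

(** The generators p, e, f come from [adapted_generators]; [brace_classification] reads off the
    action of theta on them, and [brace_iso_of_generators] turns the resulting pair (i, j) into an
    isomorphism. The pair (0, 0) is excluded because it would put f in the kernel. Conversely,
    elements of B_ij with last coordinate 1 act nontrivially, which gives the order of the kernel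
    ([card_ker_lambda_Bij]); [brace_iso_Bij_inj] separates the three braces.

    The multiplicative groups rest on one presentation: (B_ij, o) is generated by t, z, s with t^q =
    z^2 = 1, s^2 = z^j, z central and s t s^-1 = t^((-1)^i), and it maps onto any group generated by
    such elements ([homg_circgrp]). For (1, 1), z is eliminated as s^2; for (1, 0), a surjection
    onto Z_2 x D_2q is an isomorphism by counting; for (0, 1), the commuting elements s and t have
    coprime orders 4 and q, so s t generates. *)

Set Implicit Arguments.
Unset Strict Implicit.
Unset Printing Implicit Defensive.

Import GRing.Theory.

Local Open Scope group_scope.

(** * Powers with exponents in ['Z_k], and generators adapted to a subgroup of index 2 *)

Section ZpExponents.

Variables (gT : finGroupType) (k : nat) (x : gT).
Hypotheses (k_gt1 : 1 < k) (xk1 : x ^+ k = 1).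

Lemma expg_ZpD (m n : 'Z_k) : x ^+ (m + n)%R = x ^+ m * x ^+ n.
Proof.
(* Addition in ['Z_k] reduces modulo [(Zp_trunc k).+2], which is [k] because [1 < k]. *)
have -> : nat_of_ord (m + n)%R = (m + n) %% k.
  by congr (_ %% _); rewrite Zp_cast.
by rewrite expg_mod // expgD.
Qed.

Lemma expg_ZpM (m n : 'Z_k) : x ^+ (m * n)%R = x ^+ m ^+ n.
Proof.
have -> : nat_of_ord (m * n)%R = (m * n) %% k.
  by congr (_ %% _); rewrite Zp_cast.
by rewrite expg_mod // expgM.
Qed.

Lemma expg_ZpN (n : 'Z_k) : x ^+ (- n)%R = (x ^+ n)^-1.
Proof.
apply/esym/eqP; rewrite eq_invg_mul -expg_ZpD.
by rewrite (_ : (n - n)%R = 0%R) ?expg0 // subrr.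
Qed.

End ZpExponents.

(** The complement of K is a single coset, here K y^-1, and it contains x. *)
Lemma mulg_notin_index2 (gT : finGroupType) (K : {group gT}) (x y : gT) :
  #|gT| = (2 * #|K|)%N -> x \notin K -> y \notin K -> x * y \in K.
Proof.
move=> cardK xK yK; have idxK : #|[set: gT] : K| = 2.
  by rewrite -divgS ?subsetT // cardsT cardK mulnK.
have := @rcoset_index2 _ [set: gT]%G K y^-1 (subsetT K) idxK.
rewrite !inE groupV yK => /(_ isT)/setP/(_ x).
by rewrite mem_rcoset invgK !inE xK.
Qed.

(** An element of odd order lies in K. Of two generators a, b of the Klein four-group at least one
    is outside K; it serves as f, and whichever of a, b, a b lies in K serves as e. *)
Lemma adapted_generators (gT : finGroupType) (q : nat) (K : {group gT}) :
    1 < q -> odd q -> [set: gT] \isog [set: ('Z_2 * 'Z_2) * 'Z_q] ->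
    #|K| = (2 * q)%N ->
  exists p, exists e, exists f, [/\ p ^+ q = 1, e ^+ 2 = 1, f ^+ 2 = 1,
    [/\ p \in K, e \in K & f \notin K]
    & forall x : gT, exists n : 'Z_q, exists m : 'Z_2, exists l : 'Z_2,
        x = p ^+ n * e ^+ m * f ^+ l].
Proof.
move=> q1 oq isoG cardK.
have cardG : #|gT| = (4 * q)%N.
  by rewrite -cardsT (card_isog isoG) cardsT !card_prod !card_ord (Zp_cast q1).
have cG (x y : gT) : x * y = y * x.
  have cT : abelian [set: ('Z_2 * 'Z_2) * 'Z_q].
    apply/centsP=> -[[a b] c] _ [[a' b'] c'] _.
    congr (_, _, _); exact: addrC.
  by move: cT; rewrite -(isog_abelian isoG) => /centsP->.
have /isogP[h injh imh] : [set: ('Z_2 * 'Z_2) * 'Z_q] \isog [set: gT].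
  by rewrite isog_sym.
pose t1 : ('Z_2 * 'Z_2) * 'Z_q := (1%R, 0%R, 0%R).
pose t2 : ('Z_2 * 'Z_2) * 'Z_q := (0%R, 1%R, 0%R).
pose t3 : ('Z_2 * 'Z_2) * 'Z_q := (0%R, 0%R, 1%R).
have t3X n : t3 ^+ n = (0%R, 0%R, n%:R%R).
  elim: n => // n IHn; rewrite expgS IHn.
  by congr (_, _, _); [exact: addr0.. | exact: esym (mulrS _ _)].
have hD (t : ('Z_2 * 'Z_2) * 'Z_q) : t = t3 ^+ t.2 * t1 ^+ t.1.1 * t2 ^+ t.1.2.
  case: t => [[u v] n] /=; rewrite t3X natr_Zp.
  by elim/Z2P: u; elim/Z2P: v; congr (_, _, _); first
    [exact: val_inj | exact: esym (etrans (addr0 _) (addr0 _))].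
have t12 : t1 ^+ 2 = 1.
  by congr (_, _, _); first [exact: val_inj | exact: addr0].
have t22 : t2 ^+ 2 = 1.
  by congr (_, _, _); first [exact: val_inj | exact: addr0].
have t3q : t3 ^+ q = 1 by rewrite t3X pchar_Zp.
set a := h t1; set b := h t2; set p := h t3.
have a2 : a ^+ 2 = 1 by rewrite -morphX ?inE // t12 morph1.
have b2 : b ^+ 2 = 1 by rewrite -morphX ?inE // t22 morph1.
have pq : p ^+ q = 1 by rewrite -morphX ?inE // t3q morph1.
have span (x : gT) : exists n : 'Z_q, exists u : 'Z_2, exists v : 'Z_2,
    x = p ^+ n * a ^+ u * b ^+ v.
  have : x \in h @* [set: ('Z_2 * 'Z_2) * 'Z_q] by rewrite imh inE.
  case/morphimP=> t _ _ ->; exists t.2, t.1.1, t.1.2.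
  by rewrite {1}(hD t) !morphM ?morphX ?inE.
have mulK x y : x \notin K -> y \notin K -> x * y \in K.
  by apply: mulg_notin_index2; rewrite cardG cardK mulnA.
have pK : p \in K.
  (* For odd q, [uphalf q] is (q + 1) / 2, so p is a square, and squares lie in a subgroup of index
     2. *)
  have -> : p = p ^+ uphalf q * p ^+ uphalf q.
    by rewrite -expgD addnn uphalfE even_halfK ?negbK // expgS pq mulg1.
  have [pK|pK'] := boolP (p ^+ uphalf q \in K); first by rewrite groupM.
  exact: mulK.
exists p; have [aK|aK'] := boolP (a \in K); last first.
  have [bK|bK'] := boolP (b \in K).
    exists b, a; split=> // x; have [n [u [v ->]]] := span x.
    by exists n, v, u; rewrite -!mulgA [b ^+ v * _]cG.
  (* Both a and b are outside K; since a^2 = 1, a^u b^v = (a b)^v a^(u + v). *)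
  exists (a * b), a; split=> //.
  - by rewrite expgMn ?a2 ?b2 ?mulg1 //; apply: cG.
  - by split=> //; apply: mulK.
  move=> x; have [n [u [v ->]]] := span x.
  exists n, v, (u + v)%R; rewrite -!mulgA; congr (_ * _).
  rewrite expgMn; last exact: cG.
  rewrite expg_ZpD // [a ^+ v * _]cG [a ^+ u * a ^+ v]cG.
  rewrite -mulgA (mulgA (a ^+ v)).
  by rewrite -expgD addnn -mul2n expgM a2 expg1n mul1g cG.
(* If b were in K as well, K would be the whole group, of order 4q instead of 2q. *)
exists a, b; split=> //; split=> //; apply/negP=> bK.
have /setP KT : K :=: [set: gT].
  apply/setP=> x; rewrite inE; have [n [u [v ->]]] := span x.
  by rewrite !groupM ?groupX.
move: cardK; rewrite (eq_card KT) cardsT cardG => /eqP.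
by rewrite eqn_pmul2r // ltnW.
Qed.

Lemma brace_iso_sym (A B : skew_brace) : brace_iso A B -> brace_iso B A.
Proof.
case=> f [[g fK gK] fD fM]; exists g; split; first by exists f.
  by move=> x y; apply: (can_inj fK); rewrite fD !gK.
by move=> x y; apply: (can_inj fK); rewrite fM !gK.
Qed.

Lemma card_addgrp (B : skew_brace) : #|{: addgrp B}| = #|B|.
Proof.
by apply: (@bij_eq_card _ _ (fun x : addgrp B => x : B)); exists id.
Qed.

Lemma card_circgrp (B : skew_brace) : #|{: circgrp B}| = #|B|.
Proof.
by apply: (@bij_eq_card _ _ (fun x : circgrp B => x : B)); exists id.
Qed.

Lemma badd_BijE q (i j : 'Z_2) (n x : 'Z_q) (m l y z : 'Z_2) :
  @badd (brace_Bij q i j) (n, m, l) (x, y, z) = (n + x, m + y, l + z)%R.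
Proof. by []. Qed.

Lemma bcirc_BijE q (i j : 'Z_2) (n x : 'Z_q) (m l y z : 'Z_2) :
  @bcirc (brace_Bij q i j) (n, m, l) (x, y, z) =
  (n + (-1) ^+ (i * l) * x, m + y + j * l * z, l + z)%R.
Proof. by []. Qed.

(** * The map lambda as the link between the two group laws *)

Section LambdaTheory.

Variable B : skew_brace.
Implicit Types (a b : circgrp B) (x y : addgrp B).

(** Recovers the circle operation from the addition and lambda; later comparisons of the two laws go
    through it. *)
Lemma circE a b : (a * b : circgrp B) = ((a : addgrp B) * lambda a b)%g.
Proof. by rewrite permE; exact: esym (mulKVg (a : addgrp B) _). Qed.

Lemma lambdaD a x y : lambda a (x * y) = lambda a x * lambda a y.
Proof. by have /setIdP[_ /morphicP->] := lambda_Aut a; rewrite ?inE. Qed.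

Lemma lambda_one a : lambda a (1 : addgrp B) = 1.
Proof. by apply: (mulgI (lambda a 1)); rewrite -lambdaD !mulg1. Qed.

Lemma lambdaX a x n : lambda a (x ^+ n) = lambda a x ^+ n.
Proof. by elim: n => [|n IHn]; rewrite ?lambda_one // !expgS lambdaD IHn. Qed.

Lemma mem_ker_lambda a : (a \in ker_lambda B) = (lambda a == 1).
Proof. by rewrite inE. Qed.

(** For x in the kernel, x + y = x o y, so the homomorphism property of lambda applies. *)
Lemma lambda_ker_add x y : (x : circgrp B) \in ker_lambda B ->
  lambda ((x * y : addgrp B) : circgrp B) = lambda (y : circgrp B).
Proof.
rewrite mem_ker_lambda => /eqP x1.
have -> : (x * y : addgrp B) = ((x : circgrp B) * (y : circgrp B))%g :> B.
  by rewrite circE x1 perm1.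
by rewrite lambdaM x1 mulg1.
Qed.

Lemma lambda_1 : lambda (1 : circgrp B) = 1.
Proof.
apply: (mulgI (lambda (1 : circgrp B))); rewrite -lambdaM. rewrite mulg1.
by rewrite mulg1.
Qed.

(** The circle unit acts trivially, so it is also idempotent for the addition. *)
Lemma circ1E : (1 : circgrp B) = (1 : addgrp B).
Proof.
apply: (mulgI ((1 : circgrp B) : addgrp B)); rewrite mulg1.
by rewrite -[RHS](mulg1 (1 : circgrp B)) circE lambda_1 perm1.
Qed.

Lemma ker_lambda_group_set : group_set (ker_lambda B).
Proof.
apply/group_setP; split=> [|a b]; rewrite !mem_ker_lambda ?lambda_1 //.
by rewrite lambdaM => /eqP-> /eqP->; rewrite mulg1.
Qed.

(** With this the kernel is a subgroup for both laws, so index 2 arguments can be run in either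
    group. *)
Lemma ker_lambda_add_group_set : group_set (ker_lambda B : {set addgrp B}).
Proof.
apply/group_setP; split=> [|a b aK bK].
  by rewrite -circ1E mem_ker_lambda lambda_1.
by rewrite mem_ker_lambda lambda_ker_add // -mem_ker_lambda.
Qed.

End LambdaTheory.

(** * Reconstruction of the brace from the action of theta on the generators *)

Section AdaptedGenerators.

Variables (B : skew_brace) (q : nat) (i j : 'Z_2) (p e f : addgrp B).
Hypotheses (q_gt1 : 1 < q) (abB : is_left_brace B) (cardB : #|B| = (4 * q)%N).
Hypotheses (pq1 : p ^+ q = 1) (e21 : e ^+ 2 = 1) (f21 : f ^+ 2 = 1).
Hypotheses (pK : (p : circgrp B) \in ker_lambda B).
Hypotheses (eK : (e : circgrp B) \in ker_lambda B).
Hypothesis span : forall x : addgrp B,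
  exists n : 'Z_q, exists m : 'Z_2, exists l : 'Z_2,
    x = p ^+ n * e ^+ m * f ^+ l.
Local Notation theta := (lambda (f : circgrp B)).
Hypothesis thetap : theta p = p ^+ ((-1) ^+ i : 'Z_q)%R.
Hypothesis thetae : theta e = e.
Hypothesis thetaf : theta f = e ^+ j * f.

Let cB (x y : addgrp B) : x * y = y * x.
Proof. by move/centsP: abB => ab; apply: ab; rewrite inE. Qed.

Definition span_map (u : brace_Bij q i j) : addgrp B :=
  let: (n, m, l) := u in p ^+ n * e ^+ m * f ^+ l.

(** Surjective by [span], between sets of the same size 4q. *)
Lemma span_map_bij : bijective span_map.
Proof.
have surj : [set: addgrp B] \subset span_map @: [set: brace_Bij q i j].
  apply/subsetP=> x _; have [n [m [l ->]]] := span x.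
  by apply/imsetP; exists (n, m, l); rewrite ?inE.
have cardT : #|{: brace_Bij q i j}| = #|{: addgrp B}|.
  rewrite card_addgrp cardB !card_prod !card_ord (Zp_cast q_gt1).
  by rewrite -mulnA [LHS]mulnC.
apply: inj_card_bij => [|]; last by rewrite cardT.
have /imset_injP inj : #|span_map @: setT| == #|[set: brace_Bij q i j]|.
  rewrite eqn_leq leq_imset_card cardsT cardT -cardsT.
  exact: subset_leq_card surj.
by move=> u v; apply: inj; rewrite inE.
Qed.

Lemma span_mapD (u v : brace_Bij q i j) :
  span_map (badd u v) = span_map u * span_map v.
Proof.
have mulACA (a b c d : addgrp B) : (a * b) * (c * d) = (a * c) * (b * d).
  by rewrite -!mulgA (mulgA b) [b * c]cB -mulgA.
case: u v => [[n m] l] [[x y] z].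
rewrite /span_map (mulACA _ (f ^+ l)) (mulACA (p ^+ n)).
by rewrite -!expg_ZpD.
Qed.

Lemma lambda_span_map (n : 'Z_q) (m l : 'Z_2) :
  lambda (span_map (n, m, l) : circgrp B) = lambda (f ^+ l : circgrp B).
Proof.
have pnK := @groupX _ (Group (ker_lambda_add_group_set B)) p n pK.
have emK := @groupX _ (Group (ker_lambda_add_group_set B)) e m eK.
by rewrite /span_map -mulgA !lambda_ker_add.
Qed.

(** In coordinates, theta is the lambda map of B_ij at any element with last coordinate 1. *)
Lemma theta_span_map (x : 'Z_q) (y z : 'Z_2) :
  theta (span_map (x, y, z)) = span_map ((-1) ^+ i * x, y + j * z, z)%R.
Proof.
rewrite /span_map !lambdaD !lambdaX thetap thetae thetaf.
rewrite -expg_ZpM // expgMn; last exact: cB.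
by rewrite -expg_ZpM // expg_ZpD // !mulgA.
Qed.

(** By [circE] it suffices to compare lambda maps; both depend only on the last coordinate l, being
    trivial for l = 0 and theta for l = 1. *)
Lemma span_mapM (u v : brace_Bij q i j) :
  span_map (bcirc u v) = bcirc (span_map u : B) (span_map v).
Proof.
case: u v => [[n m] l] [[x y] z].
have := circE (span_map (n, m, l)) (span_map (x, y, z)).
rewrite lambda_span_map => E; apply: etrans (esym E).
elim/Z2P: l {E}.
  rewrite expg0 -circ1E lambda_1 perm1 -[RHS]span_mapD.
  congr span_map; rewrite bcirc_BijE badd_BijE.
  by rewrite muln0 expr0 mul1r mulr0 mul0r addr0.
rewrite expg1 theta_span_map -[RHS]span_mapD.
congr span_map; rewrite bcirc_BijE badd_BijE.
by rewrite muln1 mulr1 addrA.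
Qed.

Lemma brace_iso_of_generators : brace_iso B (brace_Bij q i j).
Proof.
apply: brace_iso_sym; exists span_map; split; first exact: span_map_bij.
  exact: span_mapD.
exact: span_mapM.
Qed.

End AdaptedGenerators.

(** * Classification: determining theta on p, e and f *)

Lemma expg_coprime_eq1 (gT : finGroupType) (x : gT) (m n : nat) :
  coprime m n -> x ^+ m = 1 -> x ^+ n = 1 -> x = 1.
Proof.
move=> co_mn /eqP xm /eqP xn; apply/eqP; rewrite -[x]expg1 -order_dvdn.
by rewrite -(eqP co_mn) dvdn_gcd !order_dvdn xm xn.
Qed.

(** Modulo a prime the only square roots of 1 are 1 and -1: q divides (n - 1)(n + 1). *)
Lemma involutive_power (gT : finGroupType) (x : gT) (n q : nat) :
  prime q -> #[x] = q -> x ^+ n ^+ n = x -> x ^+ n = x \/ x ^+ n = x^-1.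
Proof.
move=> q_pr ox xnn.
have n0 : 0 < n.
  by case: n xnn => // x1; move: q_pr; rewrite -ox -x1 order1.
have : (n * n = 1 %[mod q])%N.
  by apply/eqP; rewrite -ox -eq_expg_mod_order expgM xnn expg1.
move/eqP; rewrite eqn_mod_dvd ?muln_gt0 ?n0 // //.
have -> : (n * n - 1 = (n - 1) * (n + 1))%N := subn_sqr n 1.
rewrite Euclid_dvdM // -ox !order_dvdn => /orP[]/eqP E; [left|right].
  by rewrite -(subnK n0) expgD E mul1g.
by apply/esym/eqP; rewrite eq_invg_mul -expgS -addn1 E.
Qed.

Lemma brace_classification (q : nat) (B : skew_brace) :
    2 < q -> prime q -> is_left_brace B -> #|B| = (4 * q)%N ->
    [set: addgrp B] \isog [set: ('Z_2 * 'Z_2) * 'Z_q] ->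
    #|ker_lambda B| = (2 * q)%N ->
  exists i, exists j, (i, j) != (0, 0)%R /\ brace_iso B (brace_Bij q i j).
Proof.
move=> q2 q_pr abB cardB isoB cardK; have q1 := prime_gt1 q_pr.
have odd_q : odd q by case: (even_prime q_pr) q2 => // ->.
pose K := Group (ker_lambda_add_group_set B).
pose C := Group (ker_lambda_group_set B).
have cB (x y : addgrp B) : x * y = y * x.
  by move/centsP: abB => ab; apply: ab; rewrite inE.
have [p [e [f [pq1 e21 f21 [pK eK fK] span]]]] :=
  @adapted_generators _ q K q1 odd_q isoB cardK.
have inj (n : 'Z_q) (m l : 'Z_2) :
    p ^+ n * e ^+ m * f ^+ l = 1 -> [/\ n = 0, m = 0 & l = 0]%R.
  (* The zeros only fix the type of [span_map], whose formula does not involve i and j. *)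
  move=> E; have g_inj := bij_inj (span_map_bij 0%R 0%R q1 cardB span).
  have := g_inj (n, m, l) (0, 0, 0)%R.
  by rewrite /span_map E !expg0 !mulg1 => /(_ erefl)[-> -> ->].
have p1 : p != 1.
  apply/eqP=> p1; have [|/eqP] := inj 1%R 0%R 0%R.
    by rewrite p1 expg1n !mulg1.
  by rewrite oner_eq0.
have e1 : e != 1.
  apply/eqP=> e1; have [|_ /eqP] := inj 0%R 1%R 0%R; last by rewrite oner_eq0.
  by rewrite e1 !mulg1.
have mulK x y : x \notin K -> y \notin K -> x * y \in K.
  by apply: mulg_notin_index2; rewrite card_addgrp cardB [#|K|]cardK mulnA.
have mulC a b : a \notin C -> b \notin C -> a * b \in C.
  by apply: mulg_notin_index2; rewrite card_circgrp cardB [#|C|]cardK mulnA.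
pose theta := lambda (f : circgrp B).
(* f o f lies in the kernel, which has index 2 in the circle group. *)
have thetaK x : theta (theta x) = x.
  have := mulC f f fK fK; rewrite mem_ker_lambda lambdaM => /eqP/permP/(_ x).
  by rewrite permM perm1.
(* The p-component of theta x is killed both by 2 and by the odd number q. *)
have theta2 x : x ^+ 2 = 1 -> exists m : 'Z_2, exists l : 'Z_2,
    theta x = e ^+ m * f ^+ l.
  move=> x2; have [n [m [l E]]] := span (theta x).
  exists m, l; rewrite E -mulgA (_ : p ^+ n = 1) ?mul1g //.
  apply: (@expg_coprime_eq1 _ _ 2 q); first by rewrite coprime2n.
    have : theta x ^+ 2 = 1 by rewrite -lambdaX x2 lambda_one.
    rewrite E -mulgA !expgMn; try exact: cB.
    rewrite -[e ^+ m ^+ 2]expgM -[f ^+ l ^+ 2]expgM ![(_ * 2)%N]mulnC !expgM.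
    by rewrite e21 f21 !expg1n !mulg1.
  by rewrite -expgM mulnC expgM pq1 expg1n.
(* The element f o x = f + theta x is read in both groups: it is in K iff x is not, and iff theta x
   is not. *)
have theta_mem x : (theta x \in K) = (x \in K).
  have fM1 : (f * theta x \in K) = (x \notin K).
    rewrite -[f * theta x](circE (f : circgrp B) (x : circgrp B)).
    have [xC|xC] := boolP (x \in K); last exact: mulC.
    rewrite -[_ \in _]/((f : circgrp B) * (x : circgrp B) \in C).
    by rewrite groupMr ?(negbTE fK).
  have fM2 : (f * theta x \in K) = (theta x \notin K).
    have [xK|xK] := boolP (theta x \in K); last exact: mulK.
    by rewrite groupMr ?(negbTE fK).
  by apply: negb_inj; rewrite -fM1 -fM2.
have op : #[p] = q. by apply: nt_prime_order.
(* The component of theta p along e and f is killed by 2 and by q, so theta p is a power of p; as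
   theta is an involution, it is p or its inverse. *)
have [i thetap] : exists i : 'Z_2, theta p = p ^+ ((-1) ^+ i : 'Z_q)%R.
  have [n [m [l E]]] := span (theta p).
  have em1 : e ^+ m * f ^+ l = 1.
    apply: (@expg_coprime_eq1 _ _ 2 q); first by rewrite coprime2n.
      rewrite expgMn; last exact: cB.
      by rewrite -!expgM ![(_ * 2)%N]mulnC !expgM e21 f21 !expg1n mulg1.
    have -> : e ^+ m * f ^+ l = (p ^+ n)^-1 * theta p by rewrite E -mulgA mulKg.
    rewrite expgMn; last exact: cB.
    rewrite -lambdaX pq1 lambda_one expgVn -expgM mulnC expgM pq1 expg1n.
    by rewrite invg1 mulg1.
  have {em1}E : theta p = p ^+ n by rewrite E -mulgA em1 mulg1.
  have [||E'] := @involutive_power _ p n q q_pr op.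
  - by rewrite -{1}E -lambdaX -E thetaK.
  - by exists 0%R; rewrite E.
  exists 1%R; rewrite E E'.
  by rewrite -[((-1) ^+ _)%R]/(-1)%R expg_ZpN ?expg1.
have thetae : theta e = e.
  have [m [l E]] := theta2 e e21.
  (* Otherwise f would be a combination of e and theta e, both in K. *)
  have l0 : l = 0%R.
    elim/Z2P: l E => // E; case/negP: fK.
    have -> : f = (e ^+ m)^-1 * theta e by rewrite E mulKg.
    by rewrite groupM ?theta_mem // groupV groupX.
  elim/Z2P: m E; rewrite l0 mulg1 // => E.
  case/eqP: e1; apply: (can_inj thetaK); rewrite E.
  exact: esym (lambda_one _).
have [j thetaf] : exists j : 'Z_2, theta f = e ^+ j * f.
  have [m [l E]] := theta2 f f21; exists m.
  elim/Z2P: l E => // E; case/negP: fK.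
  by rewrite -theta_mem E mulg1 groupX.
exists i, j; split; last first.
  exact: (brace_iso_of_generators q1 abB cardB pq1 e21 f21 pK eK span thetap
                                  thetae thetaf).
(* With i = j = 0, theta fixes all three generators, so f would lie in the kernel. *)
apply/eqP=> -[i0 j0]; case/negP: fK; rewrite mem_ker_lambda -/theta.
apply/eqP/permP=> x; rewrite perm1; have [n [m [l ->]]] := span x.
rewrite !lambdaD !lambdaX [lambda _ p]thetap [lambda _ e]thetae.
by rewrite [lambda _ f]thetaf i0 j0 expg0 mul1g.
Qed.

Lemma isog_morph_bij (gT rT : finGroupType) (h : gT -> rT) :
  {morph h : x y / x * y} -> bijective h -> [set: gT] \isog [set: rT].
Proof.
move=> hM hb; apply/isogP; exists (Morphism (in2W hM) : {morphism setT >-> rT}).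
  by apply/injmP=> x y _ _ /(bij_inj hb).
apply/setP=> y; have [g _ gK] := hb; rewrite in_setT.
by apply/morphimP; exists (g y); rewrite ?in_setT //= gK.
Qed.

(** * The braces B_ij belong to the class *)

Section Family.

Variables (q : nat) (i j : 'Z_2).
Hypotheses (q_gt2 : 2 < q).
Let q_gt1 : 1 < q := ltnW q_gt2.

Lemma opp1_neq1_Zq : (-1 != 1 :> 'Z_q)%R.
Proof.
rewrite eq_sym -subr_eq0 opprK; apply/eqP => /(congr1 (@nat_of_ord _)).
by rewrite -[(1 + 1)%R]/(2%:R)%R val_Zp_nat // modn_small.
Qed.

Lemma Bij_left_brace : is_left_brace (brace_Bij q i j).
Proof.
apply/centsP=> -[[n m] l] _ [[x y] z] _.
apply: etrans (badd_BijE _ _ _ _ _ _ _ _) _.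
apply: etrans (esym (badd_BijE _ _ _ _ _ _ _ _)).
by rewrite addrC [(m + _)%R]addrC [(l + _)%R]addrC.
Qed.

Lemma card_Bij : #|brace_Bij q i j| = (4 * q)%N.
Proof. by rewrite !card_prod !card_ord (Zp_cast q_gt1) -mulnA [LHS]mulnC. Qed.

Lemma addgrp_Bij_isog :
  [set: addgrp (brace_Bij q i j)] \isog [set: ('Z_2 * 'Z_2) * 'Z_q].
Proof.
pose h (u : addgrp (brace_Bij q i j)) : ('Z_2 * 'Z_2) * 'Z_q :=
  let: (n, m, l) := u in (m, l, n).
apply: (@isog_morph_bij _ _ h); first by case=> [[n m] l] [[x y] z].
by exists (fun t => let: (m, l, n) := t in (n, m, l)); case=> [[]].
Qed.

Lemma lambda_BijE (n x : 'Z_q) (m l y z : 'Z_2) :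
  lambda ((n, m, l) : circgrp (brace_Bij q i j)) (x, y, z) =
  ((-1) ^+ (i * l) * x, y + j * l * z, z)%R.
Proof.
rewrite permE; apply: etrans (_ : (- n + (n + (-1) ^+ (i * l) * x),
  - m + (m + y + j * l * z), - l + (l + z)) = _)%R; first by [].
by rewrite -(addrA m) !addKr.
Qed.

Lemma ker_lambda_BijE : (i, j) != (0, 0)%R ->
  ker_lambda (brace_Bij q i j) =
  [set u : 'Z_q * 'Z_2 * 'Z_2 | u.2 == 0%R].
Proof.
move=> ij; apply/setP=> -[[n m] l]; rewrite [RHS]inE mem_ker_lambda /=.
apply/eqP/eqP=> [lam1|->]; last first.
  apply/permP=> -[[x y] z]; rewrite perm1 lambda_BijE.
  by rewrite muln0 expr0 mul1r mulr0 mul0r addr0.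
(* This one vector detects both parameters when l = 1: its image is ((-1)^i, j, 1). *)
have := congr1 (fun s : {perm _} => s ((1, 0, 1)%R : brace_Bij q i j)) lam1.
rewrite perm1 lambda_BijE => E.
have signE : ((-1) ^+ (i * l) * 1 = 1 :> 'Z_q)%R.
  exact: (congr1 (fun u : 'Z_q * 'Z_2 * 'Z_2 => u.1.1) E).
have shiftE : (0 + j * l * 1 = 0)%R.
  exact: (congr1 (fun u : 'Z_q * 'Z_2 * 'Z_2 => u.1.2) E).
move: ij signE shiftE; elim/Z2P: l {lam1 E} => // ij.
rewrite muln1 !mulr1 add0r => signE j0; move: ij signE; rewrite j0.
elim/Z2P: i => // _; rewrite -[LHS]/(-1)%R => /eqP.
by rewrite (negbTE opp1_neq1_Zq).
Qed.

Lemma card_ker_lambda_Bij : (i, j) != (0, 0)%R ->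
  #|ker_lambda (brace_Bij q i j)| = (2 * q)%N.
Proof.
move=> ij; rewrite ker_lambda_BijE //.
transitivity #|setX [set: 'Z_q * 'Z_2] [set (0%R : 'Z_2)]|.
  by apply: eq_card => -[[n m] l]; rewrite !inE.
by rewrite cardsX cards1 cardsT card_prod !card_ord (Zp_cast q_gt1) muln1 mulnC.
Qed.

End Family.

(** * Invariants separating the B_ij *)

Lemma bcirc_Bij_comm (q : nat) (i j : 'Z_2) : 2 < q ->
  commutative (@bcirc (brace_Bij q i j)) <-> i = 0%R.
Proof.
move=> q2; split=> [|->]; last first.
  move=> [[n m] l] [[x y] z]; rewrite !bcirc_BijE !mul0n !expr0 !mul1r.
  by rewrite (addrC n) (addrC m) (addrC l) mulrAC.
elim/Z2P: i => // /(_ (1, 0, 0)%R (0, 0, 1)%R).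
rewrite !bcirc_BijE => /(congr1 (fun u : 'Z_q * 'Z_2 * 'Z_2 => u.1.1)) /=.
rewrite mulr0 addr0 add0r mulr1 => /esym/eqP; rewrite -[((-1) ^+ _)%R]/(-1)%R.
by rewrite (negbTE (opp1_neq1_Zq q2)).
Qed.

Lemma bcirc_Bij_involution (q : nat) (i j : 'Z_2) :
  (forall u : brace_Bij q i j, badd u u = bzero _ -> bcirc u u = bzero _) <->
  j = 0%R.
Proof.
split=> [sq|->].
  (* The circle square of (0, 0, 1) is (0, j, 0). *)
  elim/Z2P: j sq => // /(_ (0, 0, 1)%R).
  rewrite badd_BijE bcirc_BijE mulr0 !addr0.
  have -> : (1 + 1 = 0 :> 'Z_2)%R by apply: val_inj.
  by move/(_ erefl)/(congr1 (fun u : 'Z_q * 'Z_2 * 'Z_2 => u.1.2)).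
move=> [[n m] l]; rewrite badd_BijE bcirc_BijE !mul0r addr0.
have [-> ->] : (m + m = 0)%R /\ (l + l = 0)%R.
  by rewrite -{1}[m]Z2opp -{1}[l]Z2opp !addNr.
move/(congr1 (fun u : 'Z_q * 'Z_2 * 'Z_2 => u.1.1)) => /= nn; congr (_, _, _).
(* The first coordinate is n - n, or n + n, which vanishes by [nn]. *)
rewrite -signr_odd; case: (odd _); last by rewrite expr0 mul1r.
by rewrite expr1 mulN1r subrr.
Qed.

(** An isomorphism and its inverse transport the two invariants both ways, and an element of ['Z_2]
    is determined by whether it vanishes. *)
Lemma brace_iso_Bij_inj (q : nat) (i j k l : 'Z_2) : 2 < q ->
  brace_iso (brace_Bij q i j) (brace_Bij q k l) -> (i, j) = (k, l).
Proof.
move=> q2 isoB.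
have half i1 j1 i2 j2 : brace_iso (brace_Bij q i1 j1) (brace_Bij q i2 j2) ->
    (i1 = 0 -> i2 = 0)%R /\ (j1 = 0 -> j2 = 0)%R.
  case=> f [fb fD fM]; have [g fK gK] := fb; split.
    move/(bcirc_Bij_comm i1 j1 q2) => cM.
    apply/(bcirc_Bij_comm i2 j2 q2) => u v.
    by rewrite -(gK u) -(gK v) -!fM cM.
  move/(bcirc_Bij_involution q i1) => sq.
  apply/(bcirc_Bij_involution q i2) => u.
  have f0 : f (bzero _) = bzero _.
    apply: (mulgI (f (bzero _) : addgrp (brace_Bij q i2 j2))).
    rewrite mulg1 -[LHS]fD; congr f.
    exact: (mulg1 (1 : addgrp (brace_Bij q i1 j1))).
  rewrite -(gK u) -fD -fM -f0 => /(bij_inj fb) ?; congr f; exact: sq.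
have [ik jl] := half _ _ _ _ isoB.
have [ki lj] := half _ _ _ _ (brace_iso_sym isoB).
congr pair.
  by move: ik ki {jl lj isoB}; elim/Z2P: i; elim/Z2P: k => // h1 h2;
     first [exact: esym (h1 _) | exact: h2].
by move: jl lj {ik ki isoB}; elim/Z2P: j; elim/Z2P: l => // h1 h2;
     first [exact: esym (h1 _) | exact: h2].
Qed.

(** * The multiplicative groups: generators and relations *)

Section CircMorphism.

Variables (q : nat) (i j : 'Z_2) (gT : finGroupType) (t z s : gT).
Hypothesis q_gt1 : 1 < q.
Hypotheses (tq1 : t ^+ q = 1) (z21 : z ^+ 2 = 1) (s2 : s ^+ 2 = z ^+ j).
Hypotheses (zt : commute z t) (zs : commute z s).
Hypothesis ts : t ^ s^-1 = t ^+ ((-1) ^+ i : 'Z_q)%R.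

(** Normal form of a word in t, z, s under the relations assumed in this section. *)
Definition circ_map (u : circgrp (brace_Bij q i j)) : gT :=
  let: (n, m, l) := u in t ^+ n * z ^+ m * s ^+ l.

Lemma circ_mapM : {morph circ_map : u v / u * v}.
Proof.
move=> [[n m] l] [[x y] w].
apply: etrans (congr1 circ_map (bcirc_BijE _ _ _ _ _ _ _ _)) _.
rewrite /circ_map.
have zX (a b : nat) : commute (z ^+ a) (t ^+ b) /\ commute (z ^+ a) (s ^+ b).
  by split; apply/commuteX2.
have tD := expg_ZpD q_gt1 tq1; have zD := expg_ZpD (isT : 1 < 2) z21.
elim/Z2P: l.
  rewrite muln0 expr0 mul1r mulr0 mul0r addr0 add0r expg0 mulg1 tD zD.
  by rewrite !mulgA -(mulgA (t ^+ n)) -(zX m x).1 !mulgA.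
(* When w = 1 the exponent of s wraps around in ['Z_2]; the lost s^2 = z^j is the term j l z of the
   circle law. *)
have sw : z ^+ (j * w)%R * s ^+ (1 + w)%R = s * s ^+ w.
  elim/Z2P: w; first by rewrite mulr0 mul1g addr0 mulg1.
  have -> : (1 + 1 = 0 :> 'Z_2)%R by apply: val_inj.
  by rewrite mulr1 -s2 expg0 mulg1.
have st : s * t ^+ x = (t ^ s^-1) ^+ x * s by rewrite conjgCV conjXg.
have zt' : commute (z ^+ m) ((t ^ s^-1) ^+ x).
  by rewrite ts -expgM; exact: (zX _ _).1.
have sz : s * z ^+ y = z ^+ y * s := commuteX y (esym zs : commute s z).
rewrite muln1 mulr1 expg1 tD expg_ZpM // -ts !zD -!mulgA sw; congr (_ * _).
rewrite (mulgA s) st -!mulgA (mulgA s (z ^+ y)) sz -!mulgA.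
by rewrite [RHS]mulgA zt' -!mulgA.
Qed.

(** The coordinate vectors map to t, z and s, so the image of [circ_map] is the subgroup they
    generate. *)
Lemma homg_circgrp :
  <<[set t; z; s]>> \homg [set: circgrp (brace_Bij q i j)].
Proof.
apply/homgP; exists (Morphism (in2W circ_mapM : {in setT &, _})).
apply/eqP; rewrite eqEsubset; apply/andP; split.
  apply/subsetP=> _ /morphimP[[[n m] l] _ _ ->] /=.
  by rewrite !groupM ?groupX // mem_gen // !inE eqxx ?orbT.
rewrite gen_subG; apply/subsetP=> x; rewrite !inE -orbA => /or3P[] /eqP->.
- apply/morphimP; exists ((1, 0, 0)%R : circgrp (brace_Bij q i j));
    rewrite ?inE //=.
  by rewrite !mulg1.
- apply/morphimP; exists ((0, 1, 0)%R : circgrp (brace_Bij q i j));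
    rewrite ?inE //=.
  by rewrite mul1g mulg1.
apply/morphimP; exists ((0, 0, 1)%R : circgrp (brace_Bij q i j));
    rewrite ?inE //=.
by rewrite !mul1g.
Qed.

End CircMorphism.

Section CircGenerators.

Variables (q : nat) (i j : 'Z_2).
Hypothesis q_gt1 : 1 < q.
Local Notation G := (circgrp (brace_Bij q i j)).

Definition circ_t : G := (1, 0, 0)%R.
Definition circ_z : G := (0, 1, 0)%R.
Definition circ_s : G := (0, 0, 1)%R.

Lemma circ_mulE (n x : 'Z_q) (m l y z : 'Z_2) :
  ((n, m, l) : G) * ((x, y, z) : G) =
  (n + (-1) ^+ (i * l) * x, m + y + j * l * z, l + z)%R :> G.
Proof. by []. Qed.

Let circ_simpl :=
  (muln0, muln1, expr0, addr0, add0r, @mulr0, @mul0r, @mul1r, @mulr1).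

Lemma circ_tX n : circ_t ^+ n = (n%:R, 0, 0)%R :> G.
Proof.
elim: n => // n IHn; rewrite expgS IHn circ_mulE.
by rewrite muln0 expr0 mul1r !mulr0 !addr0 mulrS.
Qed.

Lemma circ_tq : circ_t ^+ q = 1.
Proof. by rewrite circ_tX pchar_Zp. Qed.

Lemma circ_zz : circ_z ^+ 2 = 1.
Proof.
rewrite expgS expg1 circ_mulE !mulr0 !addr0.
by have -> : (1 + 1 = 0 :> 'Z_2)%R by apply: val_inj.
Qed.

Lemma circ_ss : circ_s ^+ 2 = circ_z ^+ j.
Proof.
rewrite expgS expg1 circ_mulE !mulr0 !addr0 !mulr1 add0r.
have -> : (1 + 1 = 0 :> 'Z_2)%R by apply: val_inj.
by elim/Z2P: j.
Qed.

Lemma circ_zt : commute circ_z circ_t.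
Proof.
by rewrite /commute !circ_mulE !circ_simpl.
Qed.

Lemma circ_zs : commute circ_z circ_s.
Proof. by rewrite /commute !circ_mulE !mulr0 !mul0r !addr0 !add0r. Qed.

Lemma circ_ts : circ_t ^ circ_s^-1 = circ_t ^+ ((-1) ^+ i : 'Z_q)%R.
Proof.
rewrite conjgE invgK; apply: (mulIg circ_s).
rewrite -!mulgA mulVg mulg1 circ_tX natr_Zp.
by rewrite !circ_mulE !circ_simpl.
Qed.

Lemma circ_span (u : G) : circ_map circ_t circ_z circ_s u = u.
Proof.
case: u => [[n m] l]; rewrite /circ_map circ_tX natr_Zp.
have -> : circ_z ^+ m = (0, m, 0)%R by elim/Z2P: m.
have -> : circ_s ^+ l = (0, 0, l)%R by elim/Z2P: l.
by rewrite !circ_mulE !circ_simpl.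
Qed.

End CircGenerators.

(** As j = 1, the generator z is s^2. In any group satisfying the relations, s^2 commutes with t
    because s inverts t twice, so [homg_circgrp] gives the universal property. *)
Lemma circ_B11_Grp (q : nat) : 2 < q ->
  [set: circgrp (brace_Bij q 1%R 1%R)] \isog
    Grp (s : t : s ^+ 4, t ^+ q, s * t * s^-1 = t^-1).
Proof.
move=> q2; have q1 : 1 < q := ltnW q2.
apply: intro_isoGrp => [|rT H /existsP[[s t]] /=].
  apply/existsP; exists (circ_s q 1%R 1%R, circ_t q 1%R 1%R) => /=.
  have s2 := circ_ss q 1%R 1%R; rewrite expg1 in s2.
  have s4 : circ_s q 1%R 1%R ^+ 4 = 1.
    by rewrite -[4]/(2 * 2)%N expgM s2 circ_zz.
  apply/eqP; congr (_, (_, (_, _))).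
  - apply/eqP; rewrite eqEsubset subsetT /=; apply/subsetP=> u _.
    rewrite -(circ_span u); case: u => [[n m] l]; rewrite /circ_map -s2.
    by rewrite !groupM ?groupX // mem_gen // inE cycle_id ?orbT.
  - exact: s4.
  - exact: circ_tq.
  have := @circ_ts q 1%R 1%R; rewrite conjgE invgK mulgA => E.
  apply: etrans E _.
  by rewrite -[((-1) ^+ _)%R]/(-1)%R (expg_ZpN q1 (circ_tq _ _ _)).
rewrite !xpair_eqE /= => /and4P[/eqP defH /eqP s4 /eqP tq /eqP st].
have sH : s \in H by rewrite -defH mem_gen // inE cycle_id.
have tH : t \in H by rewrite -defH mem_gen // inE cycle_id orbT.
have ts : t ^ s^-1 = t ^+ ((-1) ^+ (1%R : 'Z_2) : 'Z_q)%R.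
  rewrite -[((-1) ^+ _)%R]/(-1)%R expg_ZpN // -[t ^+ _]/t -st.
  by rewrite conjgE invgK mulgA.
have zz : (s ^+ 2) ^+ 2 = 1 by rewrite -expgM.
have zt : commute (s ^+ 2) t.
  have ts' : t ^ s^-1 = t^-1 by rewrite -st conjgE invgK mulgA.
  by rewrite /commute conjgCV expgS expg1 invMg conjgM ts' conjVg ts' invgK.
have zs : commute (s ^+ 2) s by apply/commute_sym/commuteX.
have -> : H :=: <<[set t; s ^+ 2; s]>>.
  apply/eqP; rewrite eqEsubset -{1}defH join_subG !cycle_subG gen_subG -andbA.
  apply/and3P; split; try by rewrite mem_gen // !inE eqxx ?orbT.
  by apply/subsetP=> x; rewrite !inE => /orP[/orP[]|] /eqP->; rewrite ?groupX.
exact: (homg_circgrp q1 tq zz _ zt zs ts).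
Qed.

Lemma circ_B10_isog (q : nat) : 2 < q ->
  [set: circgrp (brace_Bij q 1%R 0%R)] \isog [set: 'Z_2 * 'D_(2 * q)].
Proof.
move=> q2; have q1 : 1 < q := ltnW q2; rewrite mul2n.
have /existsP[[x y] /=] := isoGrp_hom (Grp_dihedral q1).
rewrite !xpair_eqE /= => /and4P[/eqP defD /eqP xq /eqP y2 /eqP xy].
have cardE : #|[set: circgrp (brace_Bij q 1%R 0%R)]| = #|[set: 'Z_2 * 'D_q.*2]|.
  rewrite cardsT card_circgrp card_Bij // cardsT card_prod -[#|{: 'D__}|]cardsT.
  by rewrite card_dihedral // card_ord -mul2n mulnA.
rewrite isog_sym isogEcard cardE leqnn andbT.
(* A bare [1] is the neutral element of the group ['Z_2], whereas [1%R] in [z] is its generator; x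
   is a rotation and y a reflection. *)
pose t : 'Z_2 * 'D_q.*2 := (1, x).
pose z : 'Z_2 * 'D_q.*2 := (1%R, 1).
pose s : 'Z_2 * 'D_q.*2 := (1, y).
have expgP (G1 G2 : finGroupType) (a : G1) (b : G2) n :
    (a, b) ^+ n = (a ^+ n, b ^+ n).
  by elim: n => // n IHn; rewrite !expgS IHn.
have zt : commute z t by congr (_, _); rewrite /= ?mulg1 ?mul1g.
have zs : commute z s by congr (_, _); rewrite /= ?mulg1 ?mul1g.
have tq : t ^+ q = 1 by rewrite expgP expg1n xq.
have z2 : z ^+ 2 = 1 by rewrite expgP expg1n; congr (_, _); apply: val_inj.
have s2 : s ^+ 2 = z ^+ (0%R : 'Z_2) by rewrite expgP expg1n y2.
have yV : y^-1 = y by apply/eqP; rewrite eq_invg_mul -expg2 y2.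
have ts : t ^ s^-1 = t ^+ ((-1) ^+ (1%R : 'Z_2) : 'Z_q)%R.
  rewrite -[((-1) ^+ _)%R]/(-1)%R expg_ZpN // -[t ^+ _]/t.
  congr (_, _); first exact: val_inj.
  by rewrite -[RHS]xy -[in RHS]yV.
have genT : <<[set t; z; s]>> = setT.
  apply/eqP; rewrite eqEsubset subsetT; apply/subsetP=> -[m d] _.
  have : d \in <[x]> * <[y]>.
    by rewrite -norm_joinEr ?defD ?inE // norms_cycle xy groupV cycle_id.
  case/mulsgP=> _ _ /cycleP[a ->] /cycleP[b ->] ->.
  have -> : (m, x ^+ a * y ^+ b) = t ^+ a * z ^+ m * s ^+ b.
    rewrite !expgP /= !expg1n; congr (_, _); last by rewrite /= mulg1.
    by elim/Z2P: m => /=; apply: val_inj.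
  by rewrite !groupM ?groupX // mem_gen // !inE eqxx ?orbT.
have := homg_circgrp q1 tq z2 s2 zt zs ts; rewrite genT; exact.
Qed.

Lemma circ_B01_isog (q : nat) : prime q -> 2 < q ->
  [set: circgrp (brace_Bij q 0%R 1%R)] \isog [set: 'Z_(4 * q)].
Proof.
move=> q_pr q2; have q1 : 1 < q := ltnW q2.
have q4 : 1 < 4 * q by rewrite (leq_trans q1) // leq_pmull.
set G := [set: circgrp _].
have cardG : #|G| = (4 * q)%N by rewrite cardsT card_circgrp card_Bij.
pose s := circ_s q 0%R 1%R; pose t := circ_t q 0%R 1%R.
have os : #[s] = 4.
  (* s^2 = z has order 2. *)
  apply: (@orderXprime _ 2 2 s) => //; rewrite circ_ss expg1.
  by apply: nt_prime_order; rewrite ?circ_zz.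
have ot : #[t] = q.
  apply: nt_prime_order; rewrite ?circ_tq //.
have cst : commute s t.
  have := circ_ts q 0%R 1%R; rewrite -/s -/t -[t ^+ _]/t conjgE invgK => E.
  by rewrite /commute -{2}E -!mulgA mulVg mulg1.
have ost : #[s * t] = (4 * q)%N.
  rewrite orderM // os ot // (@coprime_pexpl 2 2) // coprime2n.
  by case: (even_prime q_pr) q2 => // ->.
have defG : G = <[s * t]>.
  by apply/eqP; rewrite eq_sym eqEcard subsetT cardG -orderE ost leqnn.
rewrite isog_cyclic_card; last first.
  apply/cyclicP; exists (s * t); exact: defG.
apply/andP; split; first by apply/cyclicP; exists Zp1; exact: Zp_cycle.
by rewrite [#|[set: circgrp _]|]cardG cardsT card_ord Zp_cast.
Qed.

Local Close Scope group_scope.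

Theorem proposition7p4 (q : nat) (q_gt3 : 3 < q) (q_prime : prime q)
    (q_mod4 : q != 1 %[mod 4]) :
  let idx : seq ('Z_2 * 'Z_2) := [:: (1%R, 0%R); (0%R, 1%R); (1%R, 1%R)] in
  let in_class (B : skew_brace) : Prop :=
    [/\ is_left_brace B,
        #|B| = 4 * q,
        [set: addgrp B] \isog [set: ('Z_2 * 'Z_2) * 'Z_q]
      & #|ker_lambda B| = 2 * q] in
  [/\ forall B : skew_brace, in_class B ->
        exists2 ij, ij \in idx & brace_iso B (brace_Bij q ij.1 ij.2),
      forall ij, ij \in idx -> in_class (brace_Bij q ij.1 ij.2),
      forall ij kl, ij \in idx -> kl \in idx -> ij <> kl ->
        ~ brace_iso (brace_Bij q ij.1 ij.2) (brace_Bij q kl.1 kl.2)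
    & [/\ [set: circgrp (brace_Bij q 1%R 0%R)] \isog [set: 'Z_2 * 'D_(2 * q)],
          ([set: circgrp (brace_Bij q 1%R 1%R)] \isog
            Grp (s : t : s ^+ 4, t ^+ q, s * t * s^-1 = t^-1))%g
        & [set: circgrp (brace_Bij q 0%R 1%R)] \isog [set: 'Z_(4 * q)]]].
Proof.
move=> idx in_class; have q2 : 2 < q := ltnW q_gt3.
(* The index list consists of all nonzero pairs, the form in which the classification delivers (i,
   j). *)
have mem_idx i j : ((i, j) \in idx) = ((i, j) != (0%R, 0%R)).
  by elim/Z2P: i; elim/Z2P: j.
split.
- move=> B [abB cardB isoB cardK].
  have [i [j [ij isoBij]]] :=
    brace_classification q2 q_prime abB cardB isoB cardK.
  by exists (i, j); rewrite ?mem_idx.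
- move=> [i j]; rewrite mem_idx => ij; split.
  + exact: Bij_left_brace.
  + exact: card_Bij.
  + exact: addgrp_Bij_isog.
  exact: card_ker_lambda_Bij.
- by move=> [i j] [k l] _ _ ij_kl /(brace_iso_Bij_inj q2).
split; first exact: circ_B10_isog.
  exact: circ_B11_Grp.
exact: circ_B01_isog.
Qed.
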